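(* Groups of intermediate growth do not embed in Thompson's group $V$: if $G$ is a finitely generated group of intermediate growth, then there is no injective group homomorphism $G\to V$.
   Context: Thompson's group $V$: let $\mathfrak C=\{0,1\}^{\infty}$ be the Cantor set, and for $a\in\{0,1\}^*$ let $[a]=\{a\eta:\eta\in\{0,1\}^\infty\}$. $V$ is the group of all homeomorphisms of $\mathfrak C$ of the form $a_j\eta\mapsto b_j\eta$ ($\eta\in\{0,1\}^\infty$, $j=1,\dots,m$), where $\mathfrak C=[a_1]\sqcup\dots\sqcup[a_m]=[b_1]\sqcup\dots\sqcup[b_m]$. A finitely generated group has intermediate growth if its word growth function (number of elements of word length at most $n$) is neither bounded above by a polynomial in $n$ nor bounded below by $c^n$ for some $c>1$. *)

(* Defs.v *)
From HB Require Import structures.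
From mathcomp Require Import all_boot all_algebra finmap.
From mathcomp Require Import boolp classical_sets functions cardinality reals.
From mathcomp Require Import topology cantor.

Set Implicit Arguments.
Unset Strict Implicit.
Unset Printing Implicit Defensive.

Local Open Scope classical_set_scope.

Section Growth.
Variable G : groupType.
Implicit Types S w : seq G.

Definition word_value w : G := (\prod_(x <- w) x)%g.

Definition word_in S w : bool :=
  all (mem (S ++ [seq (x^-1)%g | x <- S])) w.

Definition word_ball S (n : nat) : set G :=
  [set g | exists w, [/\ (size w <= n)%N, word_in S w & g = word_value w]].

Definition generates S : Prop := \bigcup_n word_ball S n = [set: G].

Lemma finite_word_ball S n : finite_set (word_ball S n).
Proof.
elim: n => [|n IHn].
  apply: (@sub_finite_set _ _ [set 1%g]); last exact: finite_set1.
  move=> g [w [sw _ ->]]; move: sw; rewrite leqn0 => /nilP ->.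
  by rewrite /= /word_value big_nil.
pose A := [set` (S ++ [seq (x^-1)%g | x <- S])].
apply: (@sub_finite_set _ _
    ([set 1%g] `|` [set (x * y)%g | x in A & y in word_ball S n])).
  move=> g [] [|x w] [sw Sw ->]; first by left; rewrite /word_value big_nil.
  case/andP: Sw => Sx Sw; right; exists x; first exact: Sx.
  exists (word_value w); first by exists w.
  by rewrite /word_value big_cons.
rewrite finite_setU; split; first exact: finite_set1.
by apply: finite_image2 => //; exact: finite_seq.
Qed.

(* [fset_set] is a junk value on infinite sets only; balls are finite by
   [finite_word_ball]. *)
Definition growth S (n : nat) : nat := #|` fset_set (word_ball S n)|%fset.

End Growth.

Section IntermediateGrowth.
Import GRing.Theory Num.Theory.
Local Open Scope ring_scope.
Variable R : realType.

Definition polynomially_bounded (u : nat -> nat) : Prop :=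
  exists p : {poly R}, forall n : nat, (u n)%:R <= p.[n%:R].

Definition exponentially_bounded_below (u : nat -> nat) : Prop :=
  exists2 c : R, 1 < c & forall n : nat, c ^+ n <= (u n)%:R.

(* The choice of the finite generating set does not affect the two growth
   conditions, so that it is enough to ask for one such set. *)
Definition intermediate_growth (G : groupType) : Prop :=
  exists S : seq G,
    [/\ generates S,
        ~ polynomially_bounded (growth S) &
        ~ exponentially_bounded_below (growth S)].

End IntermediateGrowth.

Definition homeomorphism (T U : topologicalType) (f : T -> U) : Prop :=
  continuous f /\
  exists g : U -> T, [/\ continuous g, cancel f g & cancel g f].

Definition prepend (a : seq bool) (eta : cantor_space) : cantor_space :=
  fun n => if (n < size a)%N then nth false a n else eta (n - size a)%N.

Definition cylinder (a : seq bool) : set cantor_space := range (prepend a).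

Definition cylinder_partition (I : finType) (a : I -> seq bool) : Prop :=
  \bigcup_j cylinder (a j) = [set: cantor_space] /\
  trivIset [set: I] (fun j => cylinder (a j)).

Definition prefix_replacement (f : cantor_space -> cantor_space) : Prop :=
  exists (m : nat) (a b : 'I_m -> seq bool),
    [/\ cylinder_partition a, cylinder_partition b &
        forall (j : 'I_m) (eta : cantor_space),
          f (prepend (a j) eta) = prepend (b j) eta].

Definition in_thompsonV (f : cantor_space -> cantor_space) : Prop :=
  homeomorphism f /\ prefix_replacement f.

Lemma prepend_nil x : prepend [::] x = x.
Proof. by apply/funext => n; rewrite /prepend /= subn0. Qed.

Lemma prepend_cat a b x : prepend (a ++ b) x = prepend a (prepend b x).
Proof.
apply/funext => n; rewrite /prepend size_cat nth_cat.
case: (ltnP n (size a)) => [h|h]; first by rewrite (leq_trans h (leq_addr _ _)).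
by rewrite -{1}(subnKC h) ltn_add2l subnDA.
Qed.

Lemma prepend_inj a : injective (prepend a).
Proof.
move=> x y /funeqP h; apply/funext => n; have := h (n + size a)%N.
by rewrite /prepend ltnNge leq_addl /= addnK.
Qed.

Definition compat (u v : seq bool) : bool :=
  u ++ drop (size u) v == v ++ drop (size v) u.

Lemma compat_sym u v : compat u v = compat v u.
Proof. by rewrite /compat eq_sym. Qed.

Lemma prepend_meet u v x y : prepend u x = prepend v y ->
  compat u v /\ exists z, x = prepend (drop (size u) v) z /\
                          y = prepend (drop (size v) u) z.
Proof.
wlog le_uv : u v x y / (size u <= size v)%N.
  move=> H; case/orP: (leq_total (size u) (size v)) => h e; first exact: H.
  have [c [z [hx hy]]] := H _ _ _ _ h (esym e).
  by rewrite compat_sym; split=> //; exists z.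
move=> e; have vE : v = u ++ drop (size u) v.
  rewrite -[LHS](cat_take_drop (size u)); congr (_ ++ _).
  apply: (@eq_from_nth _ false); rewrite size_takel // => i hi.
  rewrite nth_take //; move/funeqP/(_ i): e.
  by rewrite /prepend hi (leq_trans hi le_uv).
have d0 : drop (size v) u = [::] by rewrite drop_oversize.
split; first by rewrite /compat d0 cats0 -vE.
exists y; rewrite d0 prepend_nil; split=> //.
by apply: (@prepend_inj u); rewrite -prepend_cat -vE.
Qed.

Lemma partition_inj (I : finType) (a : I -> seq bool) i j x y :
  cylinder_partition a -> prepend (a i) x = prepend (a j) y ->
  i = j /\ x = y.
Proof.
move=> [_ /trivIsetP da] e.
have ij : i = j.
  apply/eqP; apply/negP => /negP nij.
  have /seteqP [/(_ (prepend (a i) x)) + _] := da i j Logic.I Logic.I nij.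
  by apply; split; [exists x | exists y].
by move: e; rewrite ij => /prepend_inj.
Qed.

Lemma partition_cover (I : finType) (a : I -> seq bool) x :
  cylinder_partition a -> exists i y, x = prepend (a i) y.
Proof.
move=> [ca _]; have : [set: cantor_space] x by [].
by rewrite -ca => -[i _ [y _ <-]]; exists i, y.
Qed.

Lemma partition_intro (I : finType) (a : I -> seq bool) :
  (forall x, exists i y, x = prepend (a i) y) ->
  (forall i j x y, prepend (a i) x = prepend (a j) y -> i = j) ->
  cylinder_partition a.
Proof.
move=> ca da; split.
  apply/seteqP; split=> // x _; have [i [y ->]] := ca x.
  by exists i => //; exists y.
apply/trivIsetP => i j _ _ nij; apply/seteqP; split=> // z [[x _ <-] [y _ e]].
by move: nij; rewrite (da i j x y) ?eqxx.
Qed.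

Lemma partition_refine (I P M : finType) (c d : P -> seq bool)
    (a : M -> seq bool) (pi : I -> P) (pj : I -> M) :
  cylinder_partition c -> cylinder_partition a ->
  (forall k, compat (d (pi k)) (a (pj k))) ->
  (forall k l, pi k = pi l -> pj k = pj l -> k = l) ->
  (forall i j, compat (d i) (a j) -> exists k, pi k = i /\ pj k = j) ->
  cylinder_partition
    (fun k => c (pi k) ++ drop (size (d (pi k))) (a (pj k))).
Proof.
move=> pc pa hk inj_k sur_k; apply: partition_intro => [x|k l x y].
  have [i [xi ->]] := partition_cover x pc.
  have [j [eta e]] := partition_cover (prepend (d i) xi) pa.
  have [/sur_k [k [ki kj]] [z [-> _]]] := prepend_meet e.
  by exists k, z; rewrite ki kj prepend_cat.
rewrite !prepend_cat => /(partition_inj pc) [eij e]; apply: inj_k => //.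
have E n z : prepend (d (pi n)) (prepend (drop (size (d (pi n))) (a (pj n))) z)
    = prepend (a (pj n)) (prepend (drop (size (a (pj n))) (d (pi n))) z).
  by rewrite -!prepend_cat (eqP (hk n)).
have := E k x; rewrite e eij (E l y).
by case/(partition_inj pa).
Qed.

Lemma prefix_replacement_intro (I : finType) (a b : I -> seq bool) f :
  cylinder_partition a -> cylinder_partition b ->
  (forall j eta, f (prepend (a j) eta) = prepend (b j) eta) ->
  prefix_replacement f.
Proof.
move=> pa pb fE.
have reindex (c : I -> seq bool) : cylinder_partition c ->
    cylinder_partition (fun k : 'I_#|I| => c (enum_val k)).
  move=> pc; apply: partition_intro => [x|i j x y].
    have [i [y ->]] := partition_cover x pc.
    by exists (enum_rank i), y; rewrite enum_rankK.
  by case/(partition_inj pc) => /enum_val_inj.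
exists #|I|, (fun k => a (enum_val k)), (fun k => b (enum_val k)).
by split; [exact: reindex | exact: reindex | move=> j eta; exact: fE].
Qed.

Lemma prefix_replacement_id : prefix_replacement id.
Proof.
have pn : cylinder_partition (fun _ : unit => [::]).
  apply: partition_intro => [x|[] [] //].
  by exists tt, x; rewrite prepend_nil.
exact: (prefix_replacement_intro pn pn).
Qed.

Lemma prefix_replacement_comp f g :
  prefix_replacement f -> prefix_replacement g -> prefix_replacement (f \o g).
Proof.
move=> [m [a [b [pa pb fE]]]] [p [c [d [pc pd gE]]]].
pose I := {k : 'I_p * 'I_m | compat (d k.1) (a k.2)}.
pose pi (k : I) := (val k).1; pose pj (k : I) := (val k).2.
have hk k : compat (d (pi k)) (a (pj k)) by exact: (valP k).
have inj_k k l : pi k = pi l -> pj k = pj l -> k = l.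
  rewrite /pi /pj => e1 e2; apply: val_inj.
  by move: e1 e2; case: (val k) (val l) => ? ? [? ?] /= -> ->.
have sur_k i j : compat (d i) (a j) -> exists k, pi k = i /\ pj k = j.
  by move=> h; exists (exist _ (i, j) h).
apply: (prefix_replacement_intro
  (a := fun k => c (pi k) ++ drop (size (d (pi k))) (a (pj k)))
  (b := fun k => b (pj k) ++ drop (size (a (pj k))) (d (pi k)))).
- exact: partition_refine.
- apply: partition_refine => //.
  + by move=> k; rewrite compat_sym.
  + by move=> k l e1 e2; exact: inj_k.
  + by move=> j i; rewrite compat_sym => /sur_k [k [? ?]]; exists k.
- move=> k eta /=.
  by rewrite prepend_cat gE -prepend_cat (eqP (hk k)) !prepend_cat fE.
Qed.

Lemma prefix_replacement_inv f g : cancel f g ->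
  prefix_replacement f -> prefix_replacement g.
Proof.
move=> fK [m [a [b [pa pb fE]]]]; exists m, b, a; split=> // j eta.
by rewrite -fE fK.
Qed.

Lemma in_thompsonV_id : in_thompsonV id.
Proof.
split; last exact: prefix_replacement_id.
by split; [|exists id; split]; do ?[exact: (fun x _ => id) | by []].
Qed.

Lemma in_thompsonV_comp f g :
  in_thompsonV f -> in_thompsonV g -> in_thompsonV (f \o g).
Proof.
move=> [[cf [f' [cf' fK f'K]]] rf] [[cg [g' [cg' gK g'K]]] rg].
split; last exact: prefix_replacement_comp.
split; first by move=> x; apply: continuous_comp; [exact: cg | exact: cf].
exists (g' \o f'); split.
- by move=> x; apply: continuous_comp; [exact: cf' | exact: cg'].
- exact: can_comp.
- exact: can_comp.
Qed.

Record thompsonV := ThompsonV {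
  thompsonV_fun :> cantor_space -> cantor_space;
  thompsonV_funP : `[< in_thompsonV thompsonV_fun >] }.

HB.instance Definition _ := [isSub for thompsonV_fun].
HB.instance Definition _ := [Choice of thompsonV by <:].

Lemma thompsonVP (f : thompsonV) : in_thompsonV f.
Proof. exact/asboolP/thompsonV_funP. Qed.

Lemma thompsonV_inv_ex (f : thompsonV) :
  exists g : thompsonV, cancel f g /\ cancel g f.
Proof.
have [[cf [g [cg fK gK]]] rf] := thompsonVP f.
have gV : `[< in_thompsonV g >].
  apply/asboolP; split; last exact: prefix_replacement_inv fK rf.
  by split=> //; exists f.
by exists (ThompsonV gV).
Qed.

Definition thompsonV_one : thompsonV := ThompsonV (asboolT in_thompsonV_id).

Definition thompsonV_mul (f g : thompsonV) : thompsonV :=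
  ThompsonV (asboolT (in_thompsonV_comp (thompsonVP f) (thompsonVP g))).

Definition thompsonV_inv (f : thompsonV) : thompsonV :=
  projT1 (cid (thompsonV_inv_ex f)).

Lemma thompsonV_mulA : associative thompsonV_mul.
Proof. by move=> f g h; exact: val_inj. Qed.

Lemma thompsonV_mul1 : left_id thompsonV_one thompsonV_mul.
Proof. by move=> f; exact: val_inj. Qed.

Lemma thompsonV_mulr1 : right_id thompsonV_one thompsonV_mul.
Proof. by move=> f; exact: val_inj. Qed.

Lemma thompsonV_mulV : left_inverse thompsonV_one thompsonV_inv thompsonV_mul.
Proof.
move=> f; apply: val_inj; apply/funext => x /=.
by rewrite /thompsonV_inv; case: cid => g [fK gK] /=; exact: fK.
Qed.

Lemma thompsonV_mulrV : right_inverse thompsonV_one thompsonV_inv thompsonV_mul.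
Proof.
move=> f; apply: val_inj; apply/funext => x /=.
by rewrite /thompsonV_inv; case: cid => g [fK gK] /=; exact: gK.
Qed.

HB.instance Definition _ := isGroup.Build thompsonV
  thompsonV_mulA thompsonV_mul1 thompsonV_mulr1
  thompsonV_mulV thompsonV_mulrV.

(* Main.v *)
Require Import Defs.
From mathcomp Require Import all_boot reals.
From mathcomp Require Import all_order all_algebra finmap boolp classical_sets.
From mathcomp Require Import cardinality cantor zify lra.

(** A finitely generated group [G] of prefix replacements of the Cantor set
    either contains two elements whose products of any given length are
    pairwise distinct, so that it grows exponentially, or it grows
    polynomially.

    A point of the Cantor set is read as an infinite stack, of which a
    generator rewrites a bounded top part. If the height of the stack varies a
    lot along the trajectory of a point under a word, then by the pigeonhole
    principle the same top [u] occurs at two times between which the letters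
    below it are not touched ([ascent_repeats]); some group element then maps
    [u eta] to [u v eta] with [v] nonempty, and it attracts the cylinder of [u]
    to the point [x = u v v v ...]. There are finitely many such hyperbolic
    words [u] of bounded length, and they control everything: a trajectory that
    never visits a hyperbolic cylinder twice changes only a bounded prefix of
    its starting point ([bounded_replacement]).

    Suppose that no pair of elements has distinct products. Ping-pong shows
    that the orbit of [x] meets the cylinder of [u] only in [x]
    ([attracting_isolated]), and a group element that is the identity near [x]
    is the identity on the whole cylinder ([attracting_rigid]): otherwise its
    conjugates by powers of the attracting element give exponentially many
    products. As the group of germs at [x] that fix [x] embeds into the
    integers, an element fixing [x] agrees on the cylinder, up to a power, with
    a power of the attracting element ([attracting_power]). Consequently, if
    the orbit of [x] is finite, no other attracting fixed point is carried into
    the cylinder of [u] ([attracting_finite_orbit]).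

    The orbit of every such [x] is finite ([attracting_orbit_finite]). A
    loop-free trajectory in an infinite orbit reaches one hyperbolic cylinder
    in two points, one of which is not its attracting point [x']; the orbit of
    [x'] meets strictly fewer hyperbolic cylinders, hence is finite by
    induction, which contradicts the preceding statement.

    Finally, an element of the ball of radius [n] is determined by the images
    and the germs at the finitely many points in the orbits of attracting
    points, for which there are polynomially many choices because the stack
    height changes by a bounded amount per letter, together with the finite set
    of its bounded prefix replacements ([ball_code]). On the translates of
    hyperbolic cylinders the former decides the element by rigidity, elsewhere
    the latter does. *)

Set Implicit Arguments.
Unset Strict Implicit.
Unset Printing Implicit Defensive.

(** * Pairs of elements with exponentially many products *)

Definition binary_word (G : groupType) (a b : G) (w : seq bool) : G :=
  (\prod_(c <- w) (if c then a else b))%g.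

(** Only words of equal length are compared: this is all that exponential
    growth requires, and it follows from freeness of the semigroup. *)
Definition free_pair (G : groupType) (a b : G) := forall w w' : seq bool,
  size w = size w' -> binary_word a b w = binary_word a b w' -> w = w'.

Section FreePairs.
Variables (G : groupType) (X : Type) (act : G -> X -> X).
Hypothesis act1 : forall x, act 1%g x = x.
Hypothesis actM : forall g h x, act (g * h)%g x = act g (act h x).

Lemma binary_word_cons (a b : G) c w :
  binary_word a b (c :: w) = ((if c then a else b) * binary_word a b w)%g.
Proof. by rewrite /binary_word big_cons. Qed.

Lemma free_pair_intro (a b : G) :
  (forall w w' : seq bool, size w = size w' ->
     (a * binary_word a b w)%g <> (b * binary_word a b w')%g) ->
  free_pair a b.
Proof.
move=> ab; elim=> [|c w IHw] [|c' w'] //= [sw]; rewrite !binary_word_cons.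
case: c c' => [] [] e; first by rewrite (IHw w') //; apply: mulgI e.
- by case: (ab w w').
- by case: (ab w' w).
- by rewrite (IHw w') //; apply: mulgI e.
Qed.

Lemma ping_pong_free (U : set X) (a b : G) (x0 : X) : U x0 ->
  (forall x, U x -> U (act a x)) -> (forall x, U x -> U (act b x)) ->
  (forall x y, U x -> U y -> act a x <> act b y) -> free_pair a b.
Proof.
move=> Ux0 Ua Ub Uab.
have Uw w : U (act (binary_word a b w) x0).
  elim: w => [|c w IHw]; first by rewrite /binary_word big_nil act1.
  by rewrite binary_word_cons actM; case: c; [exact: Ua | exact: Ub].
apply: free_pair_intro => w w' _ /(congr1 (act ^~ x0)) /=.
by rewrite !actM; exact: Uab.
Qed.

(** Each conjugate [g^k t g^-k] is trivial on [g^(k+1) U] but not at [g^k x0],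
    so their products are told apart by these points. Concretely, a word in [t
    g^-1] and [g^-1] of length [m] undoes [g^m] on [g U] whatever its letters
    are, so that at a suitable point only the leftmost letter matters. *)
Lemma contracting_free (U : set X) (g t : G) (x0 : X) :
  (forall x, U x -> U (act g x)) ->
  (forall x, U x -> act t (act g x) = act g x) ->
  U x0 -> act t x0 <> x0 -> free_pair (t * g^-1)%g g^-1%g.
Proof.
move=> Ug tg Ux0 tx0.
have gK x : act g^-1%g (act g x) = x by rewrite -actM mulVg act1.
have wE w x : U x ->
    act (binary_word (t * g^-1) g^-1 w)%g (act (g ^+ size w)%g (act g x))
    = act g x.
  elim: w x => [|c w IHw] x Ux; first by rewrite /binary_word big_nil !act1.
  rewrite binary_word_cons actM /= expgSr actM IHw; last exact: Ug.
  by case: c; rewrite ?actM gK ?tg.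
apply: free_pair_intro => w w' sw.
move/(congr1 (act ^~ (act (g ^+ size w)%g (act g x0)))).
by rewrite !actM wE // sw wE // gK.
Qed.

End FreePairs.

(** * Points of the Cantor set as infinite stacks *)

Section InitialWords.
Implicit Types (x y : cantor_space) (u v : seq bool).

Definition initial x m : seq bool := mkseq x m.

Definition tail x m : cantor_space := fun n => x (m + n)%N.

Lemma size_initial x m : size (initial x m) = m.
Proof. exact: size_mkseq. Qed.

Lemma initialK x m : prepend (initial x m) (tail x m) = x.
Proof.
apply/funext => n; rewrite /prepend size_initial.
case: ltnP => [nm|mn]; last by rewrite /tail subnKC.
by rewrite /initial nth_mkseq.
Qed.

Lemma initialD x m k : initial x (m + k) = initial x m ++ initial (tail x m) k.
Proof.
rewrite /initial /mkseq iotaD map_cat add0n; congr (_ ++ _).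
by rewrite -[in LHS](addn0 m) iotaDl -map_comp.
Qed.

Lemma tail_prepend u x : tail (prepend u x) (size u) = x.
Proof.
by apply/funext => n; rewrite /tail /prepend ltnNge leq_addr addKn.
Qed.

Lemma initial_prepend u x : initial (prepend u x) (size u) = u.
Proof.
apply: (@eq_from_nth _ false); rewrite size_initial // => i iu.
by rewrite nth_mkseq // /prepend iu.
Qed.

Lemma initial_prepend_initial x y m :
  initial (prepend (initial x m) y) m = initial x m.
Proof. by rewrite -{2}(size_initial x m) initial_prepend. Qed.

Lemma initial_le x y k m :
  (k <= m)%N -> initial x m = initial y m -> initial x k = initial y k.
Proof.
move=> /subnKC <-; rewrite !initialD => /eqP.
by rewrite eqseq_cat ?size_initial // => /andP[/eqP].
Qed.

Lemma initial_inj x y : (forall m, initial x m = initial y m) -> x = y.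
Proof.
move=> e; apply/funext => n; have /(congr1 (nth false ^~ n)) := e n.+1.
by rewrite /initial !nth_mkseq.
Qed.

Lemma cylinderP u x : cylinder u x <-> initial x (size u) = u.
Proof.
split=> [[y _ <-]|e]; first exact: initial_prepend.
by exists (tail x (size u)) => //; rewrite -{2}(initialK x (size u)) e.
Qed.

Lemma cylinder_eq u x y :
  cylinder u x -> initial y (size u) = initial x (size u) -> cylinder u y.
Proof. by move=> /cylinderP ux e; apply/cylinderP; rewrite e. Qed.

Lemma cylinder_initial x m y :
  cylinder (initial x m) y <-> initial y m = initial x m.
Proof. by rewrite cylinderP size_initial. Qed.

End InitialWords.

(** * Groups acting by prefix replacement *)

Section PrefixReplacingAction.
Variables (G : groupType) (act : G -> cantor_space -> cantor_space).
Hypothesis act1 : forall x, act 1%g x = x.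
Hypothesis actM : forall g h x, act (g * h)%g x = act g (act h x).

Lemma actK g : cancel (act g) (act g^-1%g).
Proof. by move=> x; rewrite -actM mulVg act1. Qed.

Lemma actVK g : cancel (act g^-1%g) (act g).
Proof. by move=> x; rewrite -actM mulgV act1. Qed.

Lemma act_inj g : injective (act g).
Proof. exact: can_inj (actK g). Qed.

Definition replaces g a b := forall eta, act g (prepend a eta) = prepend b eta.

(** The germ of [g] at [x], seen at depth [i]. Among the elements with a given
    value at [x], the germ depends only on the shift [j - i]. *)
Definition replaces_at g x i j :=
  replaces g (initial x i) (initial (act g x) j).

Lemma replaces1 a : replaces 1%g a a.
Proof. by move=> eta; rewrite act1. Qed.

Lemma replacesM g h a b c :
  replaces g a b -> replaces h b c -> replaces (h * g)%g a c.
Proof. by move=> ga hb eta; rewrite actM ga hb. Qed.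

Lemma replacesV g a b : replaces g a b -> replaces g^-1%g b a.
Proof. by move=> ga eta; rewrite -ga actK. Qed.

Lemma replaces_cat g a b c :
  replaces g a b -> replaces g (a ++ c) (b ++ c).
Proof. by move=> ga eta; rewrite !prepend_cat ga. Qed.

Lemma replaces_tail g x i j :
  replaces_at g x i j -> tail (act g x) j = tail x i.
Proof.
move=> /(_ (tail x i)); rewrite initialK => e.
by rewrite e -{2}(size_initial (act g x) j) tail_prepend.
Qed.

Lemma replaces_atD g x i j k :
  replaces_at g x i j -> replaces_at g x (i + k) (j + k).
Proof.
move=> gx; rewrite /replaces_at !initialD (replaces_tail gx).
exact: replaces_cat.
Qed.

Lemma replaces_at_cylinder g a b x m : replaces g a b -> cylinder a x ->
  (size a <= m)%N -> replaces_at g x m (m - size a + size b).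
Proof.
move=> gab [eta _ <-] am; rewrite addnC -{1}(subnKC am).
apply: (@replaces_atD g _ (size a) (size b)).
by rewrite /replaces_at gab !initial_prepend.
Qed.

Lemma replaces_atM g h x i j k : replaces_at g x i j ->
  replaces_at h (act g x) j k -> replaces_at (h * g)%g x i k.
Proof. by rewrite /replaces_at actM; exact: replacesM. Qed.

Lemma replaces_atV g x i j :
  replaces_at g x i j -> replaces_at g^-1%g (act g x) j i.
Proof. by move=> /replacesV; rewrite /replaces_at actK. Qed.

(** Same value and same shift at [x] give the same map near [x]. *)
Lemma replaces_at_eq g h x i j y : replaces_at g x i j ->
  replaces_at h x i j -> act g x = act h x ->
  initial y i = initial x i -> act g y = act h y.
Proof.
by move=> gx hx e yx; rewrite -(initialK y i) yx gx hx e.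
Qed.

Hypothesis act_local : forall g x, exists i j, replaces_at g x i j.

Lemma act_continuous g x m : exists k, forall y,
  initial y k = initial x k -> initial (act g y) m = initial (act g x) m.
Proof.
have [i [j gx]] := act_local g x; exists (i + m)%N => y yx.
apply: (@initial_le _ _ _ (j + m)); first exact: leq_addl.
rewrite -(initialK y (i + m)) yx (replaces_atD m gx).
exact: initial_prepend_initial.
Qed.

Lemma replaces_at_initial g x i j y : replaces_at g x i j ->
  initial y i = initial x i -> initial (act g y) j = initial (act g x) j.
Proof.
move=> gx yx; rewrite -(initialK y i) yx gx.
exact: initial_prepend_initial.
Qed.

Lemma act_expg_fixed g x n : act g x = x -> act (g ^+ n)%g x = x.
Proof.
by move=> gx; elim: n => [|n IHn]; rewrite ?expg0 ?act1 // expgS actM IHn.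
Qed.

Lemma replaces_at_expg g x i d n : act g x = x ->
  replaces_at g x i (i + d) -> replaces_at (g ^+ n)%g x i (i + n * d).
Proof.
move=> gx gxd; elim: n => [|n IHn].
  by rewrite expg0 mul0n addn0 /replaces_at act1; exact: replaces1.
rewrite expgS; apply: replaces_atM IHn _; rewrite act_expg_fixed //.
by rewrite mulSn addnA; apply: replaces_atD.
Qed.

(** * Attracting cylinders *)

(** The element [g] maps [u eta] to [u v eta] with [size v = d > 0], and
    [x = u v v v ...] is its attracting fixed point in the cylinder of [u]. Recording
    [x] and [d] instead of [v] spares the periodic sequence. *)
Definition attracting g u x d :=
  [/\ cylinder u x, act g x = x, (0 < d)%N &
      replaces_at g x (size u) (size u + d)].

Definition hyperbolic u := exists g x d, attracting g u x d.

Lemma attracting_iter g u x d n y : attracting g u x d -> cylinder u y ->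
  initial (act (g ^+ n)%g y) (size u + n * d) = initial x (size u + n * d).
Proof.
move=> [/cylinderP ux gx _ gxd] /cylinderP uy.
rewrite -[in RHS](@act_expg_fixed g x n) //.
by apply: (@replaces_at_initial _ _ (size u)); rewrite ?ux ?uy //;
  exact: replaces_at_expg.
Qed.

Lemma attracting_stable g u x d n y : attracting g u x d -> cylinder u y ->
  cylinder u (act (g ^+ n)%g y).
Proof.
move=> gx uy; have [ux _ _ _] := gx; apply: cylinder_eq ux _.
by apply: initial_le (attracting_iter n gx uy); exact: leq_addr.
Qed.

Lemma attracting_limit g u x d m y n : attracting g u x d -> cylinder u y ->
  (m <= n)%N -> initial (act (g ^+ n)%g y) m = initial x m.
Proof.
move=> gx uy mn; have [_ _ d_gt0 _] := gx.
by apply: initial_le (attracting_iter n gx uy); nia.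
Qed.

Hypothesis not_free : forall a b : G, ~ free_pair a b.

(** If [h x] were another point of the cylinder, then for large [k] the
    elements [g^k] and [h g^k] would map the cylinder into disjoint
    neighbourhoods, inside it, of [x] and of [h x]. *)
Lemma attracting_isolated g u x d h : attracting g u x d ->
  cylinder u (act h x) -> act h x = x.
Proof.
move=> gx uhx; have [ux _ _ _] := gx.
apply: contrapT => hx.
have [m hxm] : exists m, initial (act h x) m <> initial x m.
  by apply: contrapT => e; apply: hx; apply: initial_inj => m;
     apply: contrapT => em; apply: e; exists m.
have [k hk] := act_continuous h x (size u + m).
have hg y : cylinder u y ->
    initial (act h (act (g ^+ (k + m))%g y)) (size u + m)
    = initial (act h x) (size u + m).
  by move=> uy; apply: hk; apply: attracting_limit gx uy _; exact: leq_addr.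
apply: (@not_free (g ^+ (k + m))%g (h * g ^+ (k + m))%g).
apply: (ping_pong_free act1 actM ux) => [y uy|y uy|y z uy uz e].
- exact: attracting_stable gx uy.
- rewrite actM; apply: cylinder_eq uhx _.
  by apply: initial_le (hg _ uy); exact: leq_addr.
- apply: hxm; rewrite -(initial_le (leq_addl _ _) (hg _ uz)) -actM -e.
  by apply: attracting_limit gx uy _; exact: leq_addl.
Qed.

(** For large [l] the element [h f^l k] carries [x] into the cylinder of [u],
    as close to [h y] as desired; by isolation it can only carry it to [x]. *)
Lemma attracting_mutual g u x d f w y e h k :
  attracting g u x d -> attracting f w y e ->
  cylinder w (act k x) -> cylinder u (act h y) -> act h y = x.
Proof.
move=> gx fy wkx uhy; apply: initial_inj => m.
have [l hl] := act_continuous h y (size u + m).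
have hfk : initial (act (h * (f ^+ l * k)) x)%g (size u + m)
    = initial (act h y) (size u + m).
  by rewrite !actM; apply: hl; exact: attracting_limit fy wkx _.
have := attracting_isolated (h := (h * (f ^+ l * k))%g) gx.
rewrite -(initial_le (leq_addl _ _) hfk) => -> //.
by apply: cylinder_eq uhy _; apply: initial_le hfk; exact: leq_addr.
Qed.

Lemma attracting_rigid g u x d t m y : attracting g u x d ->
  (forall z, initial z m = initial x m -> act t z = z) ->
  cylinder u y -> act t y = y.
Proof.
move=> gx tx uy; apply: contrapT => ty.
apply: (@not_free (t * (g ^+ m)^-1)%g ((g ^+ m)^-1)%g).
apply: (contracting_free act1 actM _ _ uy ty) => z uz.
- exact: attracting_stable gx uz.
- by apply: tx; exact: attracting_limit gx uz _.
Qed.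

(** The shifts of [f^d] and of [g^e] at [x] coincide when [e] is the shift of
    [f]; [f'] is chosen between [f] and its inverse so that this shift is
    nonnegative. *)
Lemma attracting_power g u x d f : attracting g u x d -> act f x = x ->
  exists f' e, (f' = f \/ f' = f^-1%g) /\
    forall y, cylinder u y -> act (f' ^+ d)%g y = act (g ^+ e)%g y.
Proof.
move=> gx fx.
wlog [i [e fxe]] : f fx / exists i e, replaces_at f x i (i + e).
  have [i [j fxij]] := act_local f x.
  case: (leqP i j) => ij H.
    by apply: H => //; exists i, (j - i)%N; rewrite subnKC.
  have fVx : act f^-1%g x = x by rewrite -{1}fx actK.
  have [|f' [e [f'E H']]] := H _ fVx.
    exists j, (i - j)%N; rewrite subnKC; last exact: ltnW.
    by rewrite -{1}fx; exact: replaces_atV.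
  by exists f', e; split=> //; move: f'E; rewrite invgK; case; [right|left].
exists f, e; split; first by left.
have [ux gxx _ gxd] := gx.
have fxd := replaces_at_expg d fx fxe.
have gxe := replaces_at_expg e gxx gxd.
move=> y uy; apply: (@act_inj (g ^+ e)^-1%g); rewrite actK -actM.
apply: (attracting_rigid (m := size u + i) gx _ uy) => z zx.
apply: (@act_inj (g ^+ e)%g); rewrite actM actVK.
apply: (@replaces_at_eq _ _ x (size u + i) (size u + e * d + i)) => //.
- rewrite (_ : (size u + e * d + i)%N = (i + d * e + size u)%N); last by lia.
  by rewrite addnC; exact: replaces_atD.
- exact: replaces_atD.
- by rewrite !act_expg_fixed.
Qed.

Lemma attracting_no_period g u x d n y : attracting g u x d -> cylinder u y ->
  (0 < n)%N -> act (g ^+ n)%g y = y -> y = x.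
Proof.
move=> gx uy n_gt0 gny; apply: initial_inj => m.
have <- : act (g ^+ (n * m))%g y = y by rewrite expgnA; exact: act_expg_fixed.
by apply: attracting_limit gx uy _; exact: leq_pmull.
Qed.

Lemma finite_orbit_period x f : finite_set (range (act ^~ x)) ->
  exists2 k, (0 < k)%N & act (f ^+ k)%g x = x.
Proof.
move=> /finite_seqP [s sE]; apply: contrapT => noper.
pose t := [seq act (f ^+ i)%g x | i <- iota 0 (size s).+1].
have ut : uniq t.
  rewrite map_inj_in_uniq ?iota_uniq // => i j _ _.
  wlog ij : i j / (i <= j)%N => [H|].
    by case: (leqP i j) => [|/ltnW] ij e; [|symmetry]; exact: H.
  move=> e; apply/eqP; rewrite eqn_leq ij /= leqNgt; apply/negP => lt_ij.
  apply: noper; exists (j - i)%N; first by rewrite subn_gt0.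
  by apply: (@act_inj (f ^+ i)%g); rewrite -actM -expgnDr subnKC.
have /(uniq_leq_size ut) : {subset t <= s}.
  move=> _ /mapP [i _ ->].
  have : range (act ^~ x) (act (f ^+ i)%g x) by exists (f ^+ i)%g.
  by rewrite sE.
by rewrite size_map size_iota ltnn.
Qed.

Lemma act_conj_expg f h n x :
  act ((h * f * h^-1) ^+ n)%g (act h x) = act h (act (f ^+ n)%g x).
Proof.
elim: n => [|n IHn]; first by rewrite !expg0 !act1.
by rewrite !expgS actM IHn !actM actK.
Qed.

(** Some power [F] of [h f h^-1] fixes [x]; it also fixes [h y], near which it
    is not periodic. By [attracting_power] a power of [F] or of its inverse
    agrees with [g^r] on the cylinder. If [r > 0], then [g^r] fixes [h y], so
    that [h y = x]; if [r = 0], then a power of [f] is trivial near its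
    attracting point [y], which is absurd. *)
Lemma attracting_finite_orbit g u x d f w y e h :
  attracting g u x d -> attracting f w y e ->
  finite_set (range (act ^~ x)) -> cylinder u (act h y) -> act h y = x.
Proof.
move=> gx fy finx uhy; have [/cylinderP wy fyy _ _] := fy.
have [_ _ d_gt0 _] := gx.
have [k k_gt0 kx] := finite_orbit_period (h * f * h^-1)%g finx.
have [f' [r [f'E f'g]]] := attracting_power gx kx.
have [r0|r_gt0] := posnP r; last first.
  apply: (attracting_no_period gx uhy r_gt0); rewrite -f'g //.
  apply: act_expg_fixed.
  have Fy : act ((h * f * h^-1) ^+ k)%g (act h y) = act h y.
    by rewrite act_conj_expg act_expg_fixed.
  by case: f'E => -> //; rewrite -{1}Fy actK.
have Ftriv z : cylinder u (act h z) -> act (f ^+ (k * d))%g z = z.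
  move=> uhz; apply: (@act_inj h); rewrite -act_conj_expg expgnA.
  have /esym := f'g _ uhz; rewrite r0 expg0 act1.
  case: f'E => -> // e1; rewrite {1}e1 -actM -expgMn;
    last by rewrite /commute mulgV mulVg.
  by rewrite mulgV expg1n act1.
have [m hm] := act_continuous h y (size u).
pose M := (size w + m)%N.
(* A point close to [y] but different from it. *)
pose z := prepend (initial y M) (fun n => ~~ tail y M n).
have zy : initial z M = initial y M by exact: initial_prepend_initial.
suff : z = y.
  move=> zE; have := tail_prepend (initial y M) (fun n => ~~ tail y M n).
  rewrite size_initial -/z zE => /(congr1 (fun a : cantor_space => a 0%N)).
  by case: (tail y M 0).
apply: (attracting_no_period fy (n := (k * d)%N)).
- by apply/cylinderP; rewrite -{2}wy; apply: initial_le zy; exact: leq_addr.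
- by rewrite muln_gt0 k_gt0.
- apply: Ftriv; apply: cylinder_eq uhy _.
  by apply: hm; apply: initial_le zy; exact: leq_addl.
Qed.

(** * Long excursions of the stack create attracting cylinders *)

Lemma hyperbolic_intro g u v :
  v <> [::] -> replaces g u (u ++ v) -> hyperbolic u.
Proof.
move=> v0 gu; have v_gt0 : (0 < size v)%N by case: (v) v0.
pose p : cantor_space := fun n => nth false v (n %% size v).
have vp : prepend v p = p.
  apply/funext => n; rewrite /prepend /p.
  case: ltnP => [nv|vn]; first by rewrite modn_small.
  by rewrite -[in RHS](subnK vn) modnDr.
have gE : act g (prepend u p) = prepend u p by rewrite gu prepend_cat vp.
exists g, (prepend u p), (size v); split=> //; first by exists p.
by rewrite /replaces_at gE initial_prepend -vp -prepend_cat -size_cat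
  initial_prepend.
Qed.

Section Pushdown.
Variables (L n : nat) (pt : nat -> cantor_space) (h : nat -> nat).

(** The stack heights [h] along the points [pt] are relative to an arbitrary
    origin. As long as both heights exceed the floor [k] by [L], a step does
    not touch the letters below the floor. Only the existence of group elements
    is recorded, which makes the notion invariant under reversal of time. *)
Definition height_path := forall t, (t < n)%N ->
  [/\ (h t <= h t.+1 + L)%N, (h t.+1 <= h t + L)%N &
      forall k, (k + L <= h t)%N -> (k + L <= h t.+1)%N ->
        exists g, replaces g (initial (pt t) (h t - k))
                             (initial (pt t.+1) (h t.+1 - k))].

Hypothesis hP : height_path.

Lemma height_path_conn k i j : (i <= j <= n)%N ->
  (forall t, (i <= t <= j)%N -> (k + L <= h t)%N) ->
  exists g, replaces g (initial (pt i) (h i - k)) (initial (pt j) (h j - k)).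
Proof.
move=> /andP[ij jn]; elim: j ij jn => [|j IHj] ij jn hk.
  by move: ij; rewrite leqn0 => /eqP ->; exists 1%g; exact: replaces1.
move: ij; rewrite leq_eqVlt => /predU1P[<-|].
  by exists 1%g; exact: replaces1.
rewrite ltnS => ij; have [_ _ step] := hP jn.
have [|g gP] := IHj ij (ltnW jn).
  by move=> t /andP[it tj]; apply: hk; rewrite it leqW.
have [||f fP] := step k; try by apply: hk; rewrite ?leqnn ?leqnSn ?ij ?leqW.
by exists (f * g)%g; exact: replacesM gP fP.
Qed.

Lemma last_below l i j : (i <= j)%N -> (h i <= l < h j)%N ->
  exists t, [/\ (i <= t < j)%N, (h t <= l)%N &
    forall t', (t < t' <= j)%N -> (l < h t')%N].
Proof.
move=> ij /andP[hi hj].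
have exP : exists t, (t <= j)%N && (h t <= l)%N by exists i; rewrite ij.
have ubP t : (t <= j)%N && (h t <= l)%N -> (t <= j)%N by case/andP.
case: (ex_maxnP exP ubP) => t /andP[tj ht] tmax; exists t; split=> //.
  rewrite tmax ?ij //= ltn_neqAle tj andbT; apply/eqP => e.
  by move: ht; rewrite e leqNgt hj.
move=> t' /andP[tt' t'j]; rewrite ltnNge; apply/negP => ht'.
by have := tmax t'; rewrite t'j ht' leqNgt tt' => /(_ isT).
Qed.

(** For the levels [l k = h i + k L], let [tau k] be the last time at which the
    height is at most [l k]. From then on the letters below [l k - 2 L] are
    never touched, and at that time at most [2 L] letters lie above this floor.
    Two levels with the same top [u] differ by some letters [v] inserted below
    [u], which gives an element replacing [u] by [u ++ v]. *)
Lemma ascent_repeats i j : (0 < L)%N ->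
  (forall t, (t <= n)%N -> (2 * L <= h t)%N) -> (i <= j <= n)%N ->
  (h i + #|{: (2 * L).-bseq bool}| * L < h j)%N ->
  exists t t' u, [/\ (t < t' <= n)%N, (size u <= 2 * L)%N, hyperbolic u,
    cylinder u (pt t) & cylinder u (pt t')].
Proof.
set N := #|_| => L_gt0 h2L /andP[ij jn] hij.
pose l (k : 'I_N.+1) := (h i + k * L)%N.
have lP k : (h i <= l k < h j)%N by rewrite /l; case: k => k /= kN; nia.
have [tau tauP] := choice (fun k => last_below ij (lP k)).
have htau k t : (tau k <= t <= j)%N -> (l k < h t + L)%N.
  have [/andP[it tj] ht hlast] := tauP k.
  rewrite leq_eqVlt => /andP[/predU1P[<-|tt'] t'j]; last first.
    by have := hlast t; rewrite tt' t'j => /(_ isT); lia.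
  have [|_ + _] := hP (t := tau k); first exact: leq_trans tj jn.
  by have := hlast (tau k).+1; rewrite leqnn tj => /(_ isT); lia.
pose m k := (h (tau k) - (l k - 2 * L))%N.
pose u k := initial (pt (tau k)) (m k).
have l2L k : (2 * L <= l k)%N.
  by rewrite /l; have := h2L i (leq_trans ij jn); lia.
have su k : (size (u k) <= 2 * L)%N.
  rewrite size_initial /m; have [_ + _] := tauP k; have := l2L k; lia.
pose f k : (2 * L).-bseq bool := Bseq (su k).
have /injectivePn [k1 [k2 k12 f12]] : ~~ injectiveb f.
  apply/negP => /injectiveP /leq_card; rewrite card_ord -/N; lia.
wlog lt12 : k1 k2 {k12} f12 / (k1 < k2)%N => [H|].
  move: k12; rewrite -val_eqE neq_ltn => /orP[]; first exact: H.
  by apply: H; rewrite f12.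
have u12 : u k1 = u k2 by have /(congr1 val) := f12.
have [/andP[it1 t1j] ht1 last1] := tauP k1.
have [/andP[it2 t2j] ht2 last2] := tauP k2.
have l12 : (l k1 + L <= l k2)%N by rewrite /l; nia.
have lt_t : (tau k1 < tau k2)%N.
  rewrite ltnNge; apply/negP => t21.
  by have := htau k2 (tau k1); rewrite t21 (ltnW t1j) => /(_ isT); lia.
have [|t /andP[t1t tt2]|g] :=
  @height_path_conn (l k1 - 2 * L) (tau k1) (tau k2).
- by rewrite (ltnW lt_t) (ltnW (leq_trans t2j jn)).
- have := htau k1 t; rewrite t1t (leq_trans tt2 (ltnW t2j)) => /(_ isT).
  by have := l2L k1; lia.
have m12 : m k1 = m k2.
  by rewrite -(size_initial (pt (tau k1)) (m k1)) -/(u k1) u12 size_initial.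
have -> : (h (tau k2) - (l k1 - 2 * L) = m k2 + (l k2 - l k1))%N.
  rewrite /m; have := l2L k1; have := l2L k2.
  by have := htau k2 (tau k2); rewrite leqnn (ltnW t2j) => /(_ isT); lia.
rewrite initialD -/(u k2) -u12 -/(m k1) -/(u k1) => gu.
exists (tau k1), (tau k2), (u k1); split=> //.
- by rewrite lt_t (ltnW (leq_trans t2j jn)).
- apply: hyperbolic_intro gu => /(congr1 size); rewrite size_initial /=.
  by lia.
- by apply/cylinder_initial.
- by rewrite u12; apply/cylinder_initial.
Qed.

End Pushdown.

Lemma height_path_rev L n pt h : height_path L n pt h ->
  height_path L n (fun t => pt (n - t)%N) (fun t => h (n - t)%N).
Proof.
move=> hP t tn; have -> : (n - t)%N = (n - t.+1).+1 by lia.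
have [|h1 h2 step] := hP (n - t.+1)%N; first by lia.
split=> // k k1 k2; have [//|//|g gP] := step k.
by exists g^-1%g; exact: replacesV.
Qed.

Lemma word_valueM (s t : seq G) :
  word_value (s ++ t) = (word_value s * word_value t)%g.
Proof. exact: big_cat. Qed.

(** * Finite orbits and the code of a ball *)

Section Words.
Variables (gens : seq G) (L : nat).
Hypothesis L_gt0 : (0 < L)%N.
Hypothesis gens_table : forall s x, s \in gens -> exists a b,
  [/\ (size a <= L)%N, (size b <= L)%N, cylinder a x & replaces s a b].

(** The trajectory of [x] under [w] is indexed by suffixes: time runs
    backwards, from [x] at [t = size w] to the image of [x] at [t = 0]. *)
Definition suffix_point (w : seq G) x t := act (word_value (drop t w)) x.

Lemma word_heights w x m : all (mem gens) w -> exists h, h (size w) = m /\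
  forall t, (t < size w)%N ->
  [/\ (h t <= h t.+1 + L)%N, (h t.+1 <= h t + L)%N &
      forall k, (k + L <= h t.+1)%N ->
        replaces (nth 1%g w t) (initial (suffix_point w x t.+1) (h t.+1 - k))
          (initial (suffix_point w x t) (h t - k))].
Proof.
elim: w => [|s w IHw] /=; first by exists (fun=> m).
move=> /andP[sg /IHw [h [hm hP]]].
have [a [b [aL bL ax sab]]] := gens_table (act (word_value w) x) sg.
exists (fun t => if t is t'.+1 then h t' else (h 0 + size b - size a)%N).
split=> // -[_|t /hP //] /=.
split; [lia | lia | move=> k kh].
rewrite /suffix_point /= !drop0 {2}/word_value big_cons -/(word_value w) actM.
have -> : (h 0 + size b - size a - k = h 0 - k - size a + size b)%N by lia.
by apply: replaces_at_cylinder sab ax _; lia.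
Qed.

Definition replacement_bound := (2 * (#|{: (2 * L).-bseq bool}| * L) + L)%N.

(** Without repetition in a hyperbolic cylinder the heights stay within a
    bounded distance of each other, by [ascent_repeats] for the trajectory and
    for its reversal; so the letters far enough below the initial height are
    untouched. *)
Lemma bounded_replacement w x : all (mem gens) w ->
  (forall t t' u, (t < t' <= size w)%N -> (size u <= 2 * L)%N ->
     hyperbolic u -> cylinder u (suffix_point w x t) ->
     ~ cylinder u (suffix_point w x t')) ->
  exists i j, [/\ (i <= replacement_bound)%N, (j <= replacement_bound)%N &
    replaces_at (word_value w) x i j].
Proof.
rewrite /replacement_bound; set N := #|_|.
move=> wg norep; set n := size w in norep.
have [h [hn hP]] := word_heights x (n * L + 2 * L + N * L + L) wg.
set m := (_ + L)%N in hn; set pt := suffix_point w x in norep hP.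
have path_h : height_path L n pt h.
  move=> t tn; have [h1 h2 step] := hP t tn; split=> // k _ kh.
  by exists (nth 1%g w t)^-1%g; apply: replacesV; exact: step.
have h_low t : (t <= n)%N -> (m <= h t + (n - t) * L)%N.
  move: {2}(n - t)%N (erefl (n - t)%N) => d.
  elim: d t => [|d IHd] t dE tn.
    by have -> : t = n; [lia | rewrite hn; lia].
  have [|_ h2 _] := hP t; first by rewrite -/n; lia.
  have := IHd t.+1; rewrite (_ : (n - t = (n - t.+1).+1)%N); last by lia.
  rewrite mulSn; lia.
have h2L t : (t <= n)%N -> (2 * L <= h t)%N.
  by move=> tn; have := h_low t tn; rewrite /m; nia.
have hbound i j : (i <= n)%N -> (j <= n)%N -> (h j <= h i + N * L)%N.
  move=> i_n jn; rewrite leqNgt; apply/negP => hij.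
  case: (leqP i j) => [ij|/ltnW ji].
    have [|t [t' [u [tt' su hu ut ut']]]] :=
      ascent_repeats path_h L_gt0 h2L _ hij; first by rewrite ij.
    exact: norep tt' su hu ut ut'.
  have hij' : (h (n - (n - i)) + N * L < h (n - (n - j)))%N by rewrite !subKn.
  have [t tn||t [t' [u [tt' su hu ut ut']]]] :=
      ascent_repeats (height_path_rev path_h) L_gt0 _ _ hij'.
  - by apply: h2L; exact: leq_subr.
  - by rewrite leq_sub2l //= leq_subr.
  - by apply: (norep (n - t')%N (n - t)%N u) => //; lia.
(* The floor: all heights are at least [m - N * L]. *)
pose k := (m - N * L - L)%N.
have hk t : (t <= n)%N -> (k + L <= h t)%N.
  by move=> tn; have := hbound t n tn (leqnn n); rewrite hn /k /m; lia.
have rep d : (d <= n)%N -> replaces (word_value (drop (n - d) w))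
    (initial x (m - k)) (initial (pt (n - d)%N) (h (n - d)%N - k)).
  elim: d => [|d IHd] dn.
    rewrite subn0 hn /pt /suffix_point drop_size /word_value big_nil act1.
    exact: replaces1.
  have lt_n : (n - d.+1 < n)%N by lia.
  have ndE : (n - d = (n - d.+1).+1)%N by lia.
  have [_ _ step] := hP _ lt_n.
  rewrite (drop_nth 1%g lt_n) /word_value big_cons -/(word_value _) -ndE.
  apply: replacesM (IHd (ltnW dn)) _; rewrite ndE; apply: step.
  by apply: hk; lia.
exists (m - k)%N, (h 0 - k)%N; split.
- by rewrite /k /m; lia.
- have := hbound n 0 (leqnn n) (leq0n n); rewrite hn /k /m.
  lia.
- by have := rep n (leqnn n); rewrite subnn /pt /suffix_point drop0.
Qed.

Lemma ball_replacement w x n : all (mem gens) w -> (size w <= n)%N ->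
  exists2 j, (j <= 2 * (n * L))%N & replaces_at (word_value w) x (n * L) j.
Proof.
elim: w n => [|s w IHw] n /=.
  move=> _ _; exists (n * L)%N; first by lia.
  by rewrite /word_value big_nil /replaces_at act1; exact: replaces1.
case: n => // n /andP[sg wg]; rewrite ltnS => wn.
have [j jn wj] := IHw n wg wn.
have [a [b [aL bL ax sab]]] := gens_table (act (word_value w) x) sg.
exists (j + L - size a + size b)%N; first by lia.
rewrite /word_value big_cons -/(word_value w) mulSn addnC.
apply: replaces_atM; first exact: replaces_atD wj.
by apply: replaces_at_cylinder sab ax _; lia.
Qed.

Hypothesis gens_generate :
  forall g, exists2 w, all (mem gens) w & g = word_value w.

(** A shortest word from [x] to a given point of its orbit has a trajectory
    without loops, which visits each hyperbolic cylinder at most once by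
    hypothesis. *)
Lemma finite_orbit x :
  (forall u g g', (size u <= 2 * L)%N -> hyperbolic u ->
     cylinder u (act g x) -> cylinder u (act g' x) -> act g x = act g' x) ->
  finite_set (range (act ^~ x)).
Proof.
move=> isol; set D := replacement_bound.
apply: (@sub_finite_set _ _
  [set prepend p.2 (tail x p.1) | p in [set: 'I_D.+1 * D.-bseq bool]]);
    last first.
  exact/finite_image/finite_finset.
move=> _ [g _ <-].
pose P k := `[< exists w, [/\ size w = k, all (mem gens) w &
                              act (word_value w) x = act g x] >].
have exP : exists k, P k.
  have [w wg gE] := gens_generate g.
  by exists (size w); apply/asboolP; exists w; rewrite -gE.
case: (ex_minnP exP) => k /asboolP [w [wk wg wx]] kmin.
have [|i [j [iD jD wij]]] := bounded_replacement (x := x) wg.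
  move=> t t' u /andP[tt' t'w] su hu ut ut'.
  have e : suffix_point w x t = suffix_point w x t' by exact: isol su hu ut ut'.
  have : P (size (take t w ++ drop t' w)).
    apply/asboolP; exists (take t w ++ drop t' w); split=> //.
      rewrite all_cat; apply/andP; split; apply/allP => s.
        by move=> /mem_take; exact: (allP wg).
      by move=> /mem_drop; exact: (allP wg).
    rewrite word_valueM actM -/(suffix_point w x t') -e /suffix_point -actM.
    by rewrite -word_valueM cat_take_drop.
  move/kmin; rewrite size_cat size_drop size_take -wk.
  by have -> : (t < size w)%N; [exact: leq_trans tt' t'w | lia].
have ib : (size (initial (act g x) j) <= D)%N by rewrite size_initial.
have iD' : (i < D.+1)%N by [].
exists (Ordinal iD', Bseq ib) => //=.
by rewrite -wx -(replaces_tail wij) initialK.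
Qed.

(** Induction on the number of short hyperbolic cylinders that the orbit meets.
    If [h y] lies in the cylinder attracted to [x] and differs from [x], then
    the orbit of [y] accumulates at [x], hence meets every cylinder that the
    orbit of [x] meets; but the orbit of [x] avoids the cylinder of [w] by
    [attracting_mutual]. So the orbit of [x] is finite by induction, and
    [attracting_finite_orbit] yields [h y = x]. *)
Lemma attracting_orbit_finite f w y e : attracting f w y e ->
  (size w <= 2 * L)%N -> finite_set (range (act ^~ y)).
Proof.
pose meets y := [set u : (2 * L).-bseq bool |
  `[< hyperbolic u /\ exists h, cylinder u (act h y) >]]%SET.
have meetsP v z : v \in meets z <->
    hyperbolic v /\ exists h, cylinder v (act h z).
  by rewrite finset.in_set; split=> /asboolP.
have [k] := ubnP #|meets y|; elim: k f w y e => // k IHk f w y e.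
rewrite ltnS => yk fy sw; apply: finite_orbit.
suff isol u h g x d : (size u <= 2 * L)%N -> attracting g u x d ->
    cylinder u (act h y) -> act h y = x.
  move=> u h h' su [g [x [d gx]]] uhy uhy'.
  by rewrite (isol u h g x d) // (isol u h' g x d).
move=> su gx uhy; apply: contrapT => hyx; apply: (hyx).
apply: (attracting_finite_orbit gx fy _ uhy).
apply: (IHk g u x d) => //; apply: leq_trans yk; apply: proper_card.
apply/properP; split.
  apply/fintype.subsetP => v; move=> /meetsP [hv [l vlx]].
  apply/meetsP; split=> //.
  have [m hm] := act_continuous l x (size v).
  exists (l * (g ^+ m * h))%g; apply: cylinder_eq vlx _.
  by rewrite !actM; apply: hm; exact: attracting_limit gx uhy _.
have sw' : (size w <= 2 * L)%N := sw.
exists (Bseq sw').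
  apply/meetsP; split; first by exists f, y, e.
  by exists 1%g; rewrite act1; have [] := fy.
apply/negP => /meetsP [_ [l wlx]]; apply: hyx.
exact: attracting_mutual gx fy wlx uhy.
Qed.

Hypothesis act_faithful : forall g h, (forall x, act g x = act h x) -> g = h.

Let D := replacement_bound.

(** The first component stores, for each of the [N] points [p] in the orbits of
    the chosen attracting points, the image of [p] and the shift of the germ at
    [p]; the second stores the replacements of words of bounded length. If [g]
    and [g'] have the same code, then [g'^-1 g] is trivial near every such [p],
    hence on every translate of a short hyperbolic cylinder by rigidity; a
    point outside these translates never visits a short hyperbolic cylinder, so
    that [g] acts at it by one of the stored replacements. *)
Lemma ball_code : exists N, forall n,
  exists f : G -> {ffun 'I_N -> 'I_N * 'I_(2 * (n * L)).+1} *
                  {set D.-bseq bool * D.-bseq bool},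
  forall w w', all (mem gens) w -> all (mem gens) w' ->
    (size w <= n)%N -> (size w' <= n)%N ->
    f (word_value w) = f (word_value w') -> word_value w = word_value w'.
Proof.
have /choice[xs xsP] : forall u : (2 * L).-bseq bool, exists x,
    hyperbolic u -> exists g d, attracting g u x d.
  move=> u; case: (pselect (hyperbolic u)) => [[g [x [d gx]]]|nu].
    by exists x => _; exists g, d.
  by exists (fun=> false).
pose X :=
  (\bigcup_(u in [set u | hyperbolic (val u)]) range (act ^~ (xs u)))%classic.
have /finite_seqP [s sE] : finite_set X.
  apply: bigcup_finite; first exact: finite_finset.
  move=> u /xsP [g [d gx]]; apply: attracting_orbit_finite gx _.
  exact: size_bseq.
pose pt (i : 'I_(size s)) := tnth (in_tuple s) i.
have ptP x : X x -> exists i, pt i = x.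
  by rewrite sE => /= /(tnthP (in_tuple s)) [i ->]; exists i.
have Xact g x : X x -> X (act g x).
  by move=> [u hu [h _ <-]]; exists u => //; exists (g * h)%g; rewrite ?actM.
have Xpt i : X (pt i) by rewrite sE /=; exact: mem_tnth.
exists (size s) => n.
have /choice[c cP] : forall q : G * 'I_(size s),
    exists c : 'I_(size s) * 'I_(2 * (n * L)).+1,
    (exists w, [/\ all (mem gens) w, (size w <= n)%N & q.1 = word_value w]) ->
    pt c.1 = act q.1 (pt q.2) /\ replaces_at q.1 (pt q.2) (n * L) c.2.
  move=> q; case: (pselect (exists w,
      [/\ all (mem gens) w, (size w <= n)%N & q.1 = word_value w])).
    move=> [w [wg wn ->]].
    have [i iE] := ptP _ (Xact (word_value w) _ (Xpt q.2)).
    have [j jn wj] := ball_replacement (pt q.2) wg wn.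
    by exists (i, inord j); rewrite /= inordK.
  by move=> nw; exists (q.2, ord0).
exists (fun g => ([ffun i => c (g, i)],
  [set ab : D.-bseq bool * D.-bseq bool | `[< replaces g ab.1 ab.2 >]]%SET)).
move=> w w' wg wg' wn wn'; set g := word_value w; set g' := word_value w'.
move=> [/ffunP cE /setP rE]; apply: act_faithful => z.
have [[u [h [hu uhz]]]|nz] := pselect (exists (u : (2 * L).-bseq bool) h,
    hyperbolic u /\ cylinder u (act h z)).
  have [f [d fx]] := xsP u hu; set x := xs u in fx.
  have [i iE] : exists i, pt i = act h^-1%g x.
    by apply: ptP; exists u => //; exists h^-1%g.
  have [|e1 r1] := cP (g, i); first by exists w.
  have [|e2 r2] := cP (g', i); first by exists w'.
  have := cE i; rewrite !ffunE => ci; rewrite /= ci in e1 r1.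
  rewrite /= in e2 r2.
  have ge : act g (pt i) = act g' (pt i) by rewrite -e1 e2.
  have [m hm] := act_continuous h^-1%g x (n * L).
  have := @attracting_rigid _ _ _ _ (h * (g'^-1 * g) * h^-1)%g m (act h z) fx.
  rewrite !actM actK => rig; apply: (@act_inj g'^-1%g); rewrite actK.
  apply: (@act_inj h); apply: rig => // y yx.
  rewrite !actM (replaces_at_eq r1 r2 ge) ?actK ?actVK //.
  by rewrite iE; exact: hm.
have [|i [j [iD jD gz]]] := bounded_replacement (x := z) wg.
  move=> t t' u _ su hu ut _; apply: nz.
  by exists (Bseq su), (word_value (drop t w)).
have iD' : (size (initial z i) <= D)%N by rewrite size_initial.
have jD' : (size (initial (act g z) j) <= D)%N by rewrite size_initial.
have := rE (Bseq iD', Bseq jD'); rewrite !inE /=.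
have -> : `[< replaces g (initial z i) (initial (act g z) j) >].
  exact/asboolP.
move=> /esym /asboolP /(_ (tail z i)); rewrite initialK => ->.
by rewrite -(replaces_tail gz) initialK.
Qed.

End Words.

End PrefixReplacingAction.

(** * Exponential lower bounds and polynomial upper bounds *)

Section Growth.
Variables (G : groupType) (S : seq G).

Lemma word_ball_le m n :
  (m <= n)%N -> (word_ball S m `<=` word_ball S n)%classic.
Proof.
by move=> mn g [w [wm wS ->]]; exists w; split=> //; exact: leq_trans wm mn.
Qed.

Lemma word_ballM m n g h :
  word_ball S m g -> word_ball S n h -> word_ball S (m + n) (g * h)%g.
Proof.
move=> [w [wm wS ->]] [w' [wn wS' ->]]; exists (w ++ w'); split.
- by rewrite size_cat leq_add.
- by rewrite /word_in all_cat; apply/andP.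
- by rewrite word_valueM.
Qed.

Lemma growth_ge (T : finType) (f : T -> G) n :
  injective f -> (forall t, word_ball S n (f t)) -> (#|T| <= growth S n)%N.
Proof.
move=> f_inj fS; rewrite /growth cardE -(size_map f).
apply: uniq_leq_size; first by rewrite map_inj_uniq ?enum_uniq.
move=> _ /mapP [t _ ->]; rewrite in_fset_set ?inE //; exact: finite_word_ball.
Qed.

Lemma growth_le (T : finType) (f : G -> T) n :
  (forall g h, word_ball S n g -> word_ball S n h -> f g = f h -> g = h) ->
  (growth S n <= #|T|)%N.
Proof.
move=> f_inj; have ballP g : g \in fset_set (word_ball S n) -> word_ball S n g.
  by rewrite in_fset_set ?inE //; exact: finite_word_ball.
rewrite /growth cardE -(size_map f); apply: uniq_leq_size.
  rewrite map_inj_in_uniq ?fset_uniq // => g h /ballP gS /ballP hS.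
  exact: f_inj.
by move=> t _; rewrite mem_enum.
Qed.

Import Order.TTheory GRing.Theory Num.Theory.

(** For [t] in the unit interval, [(1 + t)^k] lies below its chord [1 + (2^k -
    1) t] by convexity; take [t = 2^-m]. *)
Lemma exists_root_le2 (R : realType) m :
  exists2 c : R, (1 < c)%R & (c ^+ m <= 2)%R.
Proof.
pose t : R := ((2 ^+ m)^-1)%R.
have t_gt0 : (0 < t)%R by rewrite invr_gt0 exprn_gt0.
have t_le1 : (t <= 1)%R by rewrite invf_le1 ?exprn_gt0 // exprn_ege1 ?ler1n.
exists (1 + t)%R; first by rewrite ltrDl.
have bound k : ((1 + t) ^+ k <= 1 + (2 ^+ k - 1) * t)%R.
  elim: k => [|k IHk]; first by rewrite !expr0 subrr mul0r addr0.
  have p1 : (1 <= 2 ^+ k :> R)%R by rewrite exprn_ege1 ?ler1n.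
  have := mulr_ge0 (mulr_ge0 (_ : 0 <= 2 ^+ k - 1)%R (ltW t_gt0))
    (_ : 0 <= 1 - t)%R.
  rewrite !subr_ge0 => /(_ p1 t_le1) pt.
  rewrite !exprS; apply: le_trans (ler_wpM2l _ IHk) _; first by lra.
  lra.
apply: le_trans (bound m) _; rewrite mulrBl mul1r.
have -> : (2 ^+ m * t = 1 :> R)%R by rewrite mulfV // expf_neq0 ?pnatr_eq0.
lra.
Qed.

(** Balls of radius [k L] contain the [2^k] products of length [k]. A base [c]
    with [c^(2 L) <= 2] absorbs the rounding of [n / L] for [n >= L]; for [0 <
    n < L] the ball still has two elements, because some generator is not the
    identity. *)
Lemma free_pair_exponential (R : realType) (a b : G) :
  generates S -> free_pair a b -> exponentially_bounded_below R (growth S).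
Proof.
move=> gS fab.
have ballE g : exists n, word_ball S n g.
  by have : [set: G]%classic g by []; rewrite -gS => -[n _ gn]; exists n.
have [la aS] := ballE a; have [lb bS] := ballE b.
pose L := (la + lb).+1.
have wS w : word_ball S (size w * L) (binary_word a b w).
  elim: w => [|c w IHw].
    by exists [::]; split; rewrite // /binary_word /word_value !big_nil.
  rewrite binary_word_cons mulSn; apply: word_ballM IHw.
  by case: c; [apply: (word_ball_le _ aS) | apply: (word_ball_le _ bS)];
    rewrite /L; lia.
have grow2 k n : (k * L <= n)%N -> (2 ^ k <= growth S n)%N.
  move=> kn; rewrite -card_bool -card_tuple.
  apply: (growth_ge (f := fun t : k.-tuple bool => binary_word a b t)).
    by move=> s t e; apply: val_inj; apply: fab e; rewrite !size_tuple.
  move=> t; apply: (word_ball_le kn); rewrite -{1}(size_tuple t); exact: wS.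
have [s sS s1] : exists2 s, s \in S & s <> 1%g.
  apply: contrapT => triv.
  have S1 x : x \in S -> x = 1%g.
    by move=> xS; apply: contrapT => x1; apply: triv; exists x.
  have all1 w : word_in S w -> word_value w = 1%g.
    move=> /allP wS'; rewrite /word_value big_seq big1 // => x /wS' /=.
    rewrite mem_cat => /orP[xS|/mapP[y yS ->]]; first exact: S1.
    by rewrite (S1 y yS) invg1.
  have [w [_ wS' aE]] := aS; have [w' [_ wS'' bE]] := bS.
  have := fab [:: true] [:: false] erefl.
  by rewrite /binary_word !big_seq1 aE bE !all1 // => /(_ erefl).
have grow1 n : (0 < n)%N -> (2 <= growth S n)%N.
  move=> n_gt0; rewrite -card_bool.
  apply: (growth_ge (f := fun c : bool => if c then s else 1%g)).
    by case=> [] [] // e; case: s1.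
  case; last by exists [::]; split; rewrite // /word_value big_nil.
  exists [:: s]; split; rewrite // ?/word_value ?big_seq1 //.
  by rewrite /word_in /= mem_cat sS.
have [c c_gt1 c2] := exists_root_le2 R (2 * L).
exists c => // n; have c_ge1 := ltW c_gt1.
have [n0|n_gt0] := posnP n.
  by rewrite n0 expr0 ler1n -(expn0 2); exact: grow2.
have L_gt0 : (0 < L)%N by [].
have nE := divn_eq n L; have mL := ltn_pmod n L_gt0.
have [k0|k_gt0] := posnP (n %/ L).
  apply: le_trans (_ : 2%:R <= _)%R; last by rewrite ler_nat grow1.
  apply: le_trans c2; rewrite ler_weXn2l //; lia.
apply: le_trans (_ : (2 ^ (n %/ L))%:R <= _)%R; last first.
  by rewrite ler_nat; apply: grow2; exact: leq_trunc_div.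
apply: (@le_trans _ _ (c ^+ (2 * L * (n %/ L)))%R).
  by rewrite ler_weXn2l //; nia.
rewrite exprM natrX; apply: lerXn2r => //; rewrite nnegrE //.
by apply: exprn_ge0; apply: le_trans c_ge1.
Qed.

End Growth.

Section PolynomialBound.
Import Order.TTheory GRing.Theory Num.Theory.
Local Open Scope ring_scope.

Lemma polynomially_bounded_intro (R : realType) (u : nat -> nat) N L K :
  (forall n, (u n <= (N * (2 * (n * L)).+1) ^ N * K)%N) ->
  polynomially_bounded R u.
Proof.
move=> le_u; exists ((N%:R *: ((2 * L)%:R *: 'X + 1)) ^+ N * K%:R%:P) => n.
apply: (@le_trans _ _ ((N * (2 * (n * L)).+1) ^ N * K)%:R).
  by rewrite ler_nat.
rewrite !hornerE natrM natrX natrM -natr1 !natrM.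
by rewrite mulrAC.
Qed.

End PolynomialBound.

(** * Subgroups of Thompson's group *)

Lemma prefix_replacement_table f : prefix_replacement f ->
  exists L, forall x, exists a b, [/\ (size a <= L)%N, (size b <= L)%N,
    cylinder a x & forall eta, f (prepend a eta) = prepend b eta].
Proof.
move=> [m [a [b [pa _ fE]]]].
exists (\max_(j < m) (size (a j) + size (b j)))%N => x.
have [j [y ->]] := partition_cover x pa.
have /= := @leq_bigmax _ (fun j => size (a j) + size (b j))%N j.
by set m0 := \max_(_ < _) _ => jm; exists (a j), (b j); split=> //;
  [lia | lia | exists y].
Qed.

Theorem corollaryD (R : realType) (G : groupType)
    (hG : intermediate_growth R G) :
  ~ exists phi : {multiplicative G -> thompsonV}, injective phi.
Proof.
move=> [phi phi_inj]; case: hG => S [gS notpoly notexp].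
pose act (g : G) : cantor_space -> cantor_space := phi g.
have phi1 : phi 1%g = 1%g by apply: (mulgI (phi 1%g)); rewrite -gmulfM !mulg1.
have act1 x : act 1%g x = x by rewrite /act phi1.
have actM g h x : act (g * h)%g x = act g (act h x) by rewrite /act gmulfM.
have act_faithful g h : (forall x, act g x = act h x) -> g = h.
  by move=> gh; apply: phi_inj; apply: val_inj; apply/funext.
have table g : exists L, forall x, exists a b,
    [/\ (size a <= L)%N, (size b <= L)%N, cylinder a x & replaces act g a b].
  by apply: prefix_replacement_table; case: (thompsonVP (phi g)).
have act_local g x : exists i j, replaces_at act g x i j.
  have [L /(_ x) [a [b [_ _ ax gab]]]] := table g.
  exists (size a), (size a - size a + size b)%N.
  exact: replaces_at_cylinder gab ax (leqnn _).
have not_free (a b : G) : ~ free_pair a b.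
  by move=> /(free_pair_exponential R gS).
pose gens := S ++ [seq (x^-1)%g | x <- S].
have gens_generate g : exists2 w, all (mem gens) w & g = word_value w.
  have : [set: G]%classic g by [].
  by rewrite -gS => -[n _ [w [_ wS ->]]]; exists w.
have [L L_gt0 gens_table] : exists2 L, (0 < L)%N &
    forall s x, s \in gens -> exists a b,
      [/\ (size a <= L)%N, (size b <= L)%N, cylinder a x & replaces act s a b].
  elim: gens {gens_generate} => [|s l [L L_gt0 IH]]; first by exists 1%N.
  have [M MP] := table s; exists (L + M)%N => [|t x]; first by lia.
  rewrite inE => /predU1P[->|/(IH t x)].
    by have [a [b [? ? ? ?]]] := MP x; exists a, b; split=> //; lia.
  by move=> [a [b [? ? ? ?]]]; exists a, b; split=> //; lia.
have [N code] := ball_code act1 actM act_local not_free L_gt0 gens_table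
  gens_generate act_faithful.
apply: notpoly; set K := #|{: {set (replacement_bound L).-bseq bool *
  (replacement_bound L).-bseq bool}}| in code.
apply: (@polynomially_bounded_intro _ _ N L K) => n.
have [f f_inj] := code n.
have cardC : #|{: {ffun 'I_N -> 'I_N * 'I_(2 * (n * L)).+1}}|
    = ((N * (2 * (n * L)).+1) ^ N)%N.
  by rewrite card_ffun card_prod !card_ord.
rewrite -cardC -card_prod.
apply: (growth_le (f := f)) => g h [w [wn wS ->]] [w' [wn' wS' ->]].
exact: f_inj.
Qed.
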